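(* Let $\Sigma$ be a finite set. An $L_\Sigma$-structure is a model of $T_{\mathrm{MSO}(\Sigma^* )}$ if and only if it is a model of $\bigcap_{w\in\Sigma^*}\mathrm{Th}(\mathrm{MSO}(w))$; that is, $T_{\mathrm{MSO}(\Sigma^* )}$ axiomatises the pseudofinite monadic second order theory of $\Sigma$-words.
   Context: $L_\Sigma$ is the first-order signature $\{\subseteq,\prec,\mathrm{At},\bot,(P_\sigma)_{\sigma\in\Sigma}\}$ ($\subseteq,\prec$ binary relation symbols, $\mathrm{At}$, $P_\sigma$ unary relation symbols, $\bot$ a constant). $\Sigma^*$ is the set of finite $\Sigma$-words, i.e. functions $w:\alpha_w\to\Sigma$ with $\alpha_w$ a finite linear order (including the empty word). For $w\in\Sigma^*$, $\mathrm{MSO}(w)$ is the $L_\Sigma$-structure with universe the power set $\mathcal{P}(\alpha_w)$, $\subseteq$ set inclusion, $A\prec B$ iff $a<b$ for some $a\in A,b\in B$, $\mathrm{At}$ the set of singletons, $\bot=\emptyset$, and $P_\sigma=\{\{a\}:w(a)=\sigma\}$. Convention: lower-case variables $x,y,z$ range over atoms (i.e. quantifiers over them are relativised to $\mathrm{At}$), and $X(x)$ abbreviates $x\subseteq X$. $T_{\mathrm{MSO}(\Sigma^* )}$ is the $L_\Sigma$-theory expressing: (1) $\subseteq$ is the order of an atomic Boolean algebra (every non-bottom element lies above an atom, atoms being minimal non-bottom elements) and $\mathrm{At}$ holds exactly of the atoms; (2) $\bot$ is the bottom element; (3) the atoms are linearly ordered by $\prec$; (4) this linear order on atoms is discrete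 with a least and a greatest element; (5) every element other than $\bot$ lies above an atom which is $\prec$-least among the atoms below it; (6) $\forall X,Y\,(X\prec Y\leftrightarrow\exists x\exists y(X(x)\wedge Y(y)\wedge x\prec y))$; (7) the $P_\sigma$ ($\sigma\in\Sigma$) partition the set of atoms (each atom in exactly one, empty parts allowed); (8) the comprehension schema: for every $L_\Sigma$-formula $\phi(x,\bar Y)$ the sentence $\forall\bar Y\exists Z\forall x(Z(x)\leftrightarrow\phi(x,\bar Y))$.
   Formalization: In axiom (4) a least and a greatest atom are required only if there is an atom; read unconditionally, (4) fails in MSO of the empty word, which satisfies the intersection of theories, so the stated equivalence would be false. *)

(* Defs.v *)
From HB Require Import structures.
From mathcomp Require Import all_boot all_order.

Set Implicit Arguments.
Unset Strict Implicit.
Unset Printing Implicit Defensive.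

Declare Scope fo_scope.
Delimit Scope fo_scope with FO.

(* First-order logic with equality over the signature L_Sigma.  Variables are  *)
(* named by natural numbers and all range over the whole universe; the atom    *)
(* variables of the paper are obtained with the relativised quantifiers        *)
(* FAllAt and FExAt below.                                                     *)

Inductive term : Type := Var of nat | Bot.
Coercion Var : nat >-> term.

Inductive formula (Sigma : Type) : Type :=
| FFalse
| FEq of term & term
| FSub of term & term
| FPrec of term & term
| FAt of term
| FP of Sigma & term
| FImp of formula Sigma & formula Sigma
| FAnd of formula Sigma & formula Sigma
| FOr of formula Sigma & formula Sigma
| FAll of nat & formula Sigma
| FEx of nat & formula Sigma.

Arguments FFalse {Sigma}.
Arguments FEq {Sigma}.
Arguments FSub {Sigma}.
Arguments FPrec {Sigma}.
Arguments FAt {Sigma}.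

Bind Scope fo_scope with formula.

Definition FNot Sigma (p : formula Sigma) := FImp p FFalse.
Definition FIff Sigma (p q : formula Sigma) := FAnd (FImp p q) (FImp q p).
Definition FAllAt Sigma (x : nat) (p : formula Sigma) :=
  FAll x (FImp (FAt x) p).
Definition FExAt Sigma (x : nat) (p : formula Sigma) :=
  FEx x (FAnd (FAt x) p).

Notation "s ≐ t" := (FEq s t) (at level 70, no associativity) : fo_scope.
Notation "s ⊆ t" := (FSub s t) (at level 70, no associativity) : fo_scope.
Notation "s ≺ t" := (FPrec s t) (at level 70, no associativity) : fo_scope.
Notation "~ p" := (FNot p) : fo_scope.
Notation "p /\ q" := (FAnd p q) : fo_scope.
Notation "p \/ q" := (FOr p q) : fo_scope.
Notation "p ⟹ q" := (FImp p q) (at level 92, right associativity) : fo_scope.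
Notation "p ⟺ q" := (FIff p q) (at level 95, no associativity) : fo_scope.
Notation "'ALL' X , p" := (FAll X p)
  (at level 200, X at level 0, p at level 200) : fo_scope.
Notation "'EX' X , p" := (FEx X p)
  (at level 200, X at level 0, p at level 200) : fo_scope.
Notation "'ALLAT' x , p" := (FAllAt x p)
  (at level 200, x at level 0, p at level 200) : fo_scope.
Notation "'EXAT' x , p" := (FExAt x p)
  (at level 200, x at level 0, p at level 200) : fo_scope.

Definition term_fv (t : term) : seq nat := if t is Var x then [:: x] else [::].

Fixpoint fv Sigma (p : formula Sigma) : seq nat :=
  match p with
  | FFalse => [::]
  | FEq s t | FSub s t | FPrec s t => term_fv s ++ term_fv t
  | FAt t | FP _ t => term_fv t
  | FImp q r | FAnd q r | FOr q r => fv q ++ fv r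
  | FAll x q | FEx x q => [seq y <- fv q | y != x]
  end.

Definition sentence Sigma (p : formula Sigma) : bool := nilp (fv p).

Record structure (Sigma : Type) : Type := Structure {
  carrier :> Type;
  s_sub : carrier -> carrier -> Prop;
  s_prec : carrier -> carrier -> Prop;
  s_at : carrier -> Prop;
  s_bot : carrier;
  s_P : Sigma -> carrier -> Prop
}.

Definition upd (T : Type) (e : nat -> T) (x : nat) (a : T) : nat -> T :=
  fun y => if y == x then a else e y.

Definition eval Sigma (M : structure Sigma) (e : nat -> M) (t : term) : M :=
  match t with Var x => e x | Bot => s_bot M end.

Fixpoint sat Sigma (M : structure Sigma) (e : nat -> M) (p : formula Sigma)
    : Prop :=
  match p with
  | FFalse => False
  | FEq s t => eval e s = eval e t
  | FSub s t => s_sub (eval e s) (eval e t)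
  | FPrec s t => s_prec (eval e s) (eval e t)
  | FAt t => s_at (eval e t)
  | FP a t => s_P a (eval e t)
  | FImp q r => sat e q -> sat e r
  | FAnd q r => sat e q /\ sat e r
  | FOr q r => sat e q \/ sat e r
  | FAll x q => forall a : M, sat (upd e x a) q
  | FEx x q => exists a : M, sat (upd e x a) q
  end.

Definition holds Sigma (M : structure Sigma) (p : formula Sigma) : Prop :=
  forall e : nat -> M, sat e p.

Definition theory (Sigma : Type) := formula Sigma -> Prop.

Definition models Sigma (M : structure Sigma) (T : theory Sigma) : Prop :=
  forall p, T p -> holds M p.

Definition Th Sigma (M : structure Sigma) : theory Sigma :=
  fun p => sentence p /\ holds M p.

(* A finOrderType may be empty, so the empty word is included. *)
Record word (Sigma : Type) : Type := Word {
  word_disp : Order.disp_t;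
  word_dom : finOrderType word_disp;
  letter :> word_dom -> Sigma
}.

Definition MSO Sigma (w : word Sigma) : structure Sigma := {|
  carrier := {set word_dom w};
  s_sub := fun A B => A \subset B;
  s_prec := fun A B => exists a b, [/\ a \in A, b \in B & (a < b)%O];
  s_at := fun A => exists a, A = [set a];
  s_bot := set0;
  s_P := fun s A => exists2 a, A = [set a] & w a = s
|}.

(* The intersection of the theories Th(MSO(w)), for w a finite word. *)
Definition Th_MSO_words (Sigma : Type) : theory Sigma :=
  fun p => forall w : word Sigma, Th (MSO w) p.

Local Notation vX := 0.
Local Notation vY := 1.
Local Notation vZ := 2.
Local Notation vx := 3.
Local Notation vy := 4.
Local Notation vz := 5.
Local Notation vU := 6.
Local Notation vJ := 7.
Local Notation vM := 8.
Local Notation vA := 9.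
Local Notation vB := 10.

Local Open Scope fo_scope.

(* The next four formulas bind vU, which must not occur in their arguments.   *)
Definition is_top Sigma (t : term) : formula Sigma := ALL vU, vU ⊆ t.
Definition is_meet Sigma (m s t : term) : formula Sigma :=
  ALL vU, (vU ⊆ m ⟺ vU ⊆ s /\ vU ⊆ t).
Definition is_join Sigma (j s t : term) : formula Sigma :=
  ALL vU, (j ⊆ vU ⟺ s ⊆ vU /\ t ⊆ vU).
Definition is_atom Sigma (t : term) : formula Sigma :=
  ~ (t ≐ Bot) /\ ALL vU, (vU ⊆ t ⟹ vU ≐ Bot \/ vU ≐ t).

Arguments is_top {Sigma}.
Arguments is_meet {Sigma}.
Arguments is_join {Sigma}.
Arguments is_atom {Sigma}.

Definition FAlls Sigma (xs : seq nat) (p : formula Sigma) : formula Sigma :=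
  foldr (@FAll Sigma) p xs.

(* The empty word has no positions.  Hence the Boolean algebra may be trivial, *)
(* and a least and a greatest atom are required only if there is an atom.      *)
Inductive T_MSO (Sigma : finType) : formula Sigma -> Prop :=
| T_sub_refl : T_MSO (ALL vX, vX ⊆ vX)
| T_sub_anti : T_MSO (ALL vX, ALL vY, (vX ⊆ vY /\ vY ⊆ vX ⟹ vX ≐ vY))
| T_sub_trans :
    T_MSO (ALL vX, ALL vY, ALL vZ, (vX ⊆ vY /\ vY ⊆ vZ ⟹ vX ⊆ vZ))
| T_meet : T_MSO (ALL vX, ALL vY, EX vZ, is_meet vZ vX vY)
| T_join : T_MSO (ALL vX, ALL vY, EX vZ, is_join vZ vX vY)
| T_distr : (* if J = Y + Z, M = X J, A = X Y and B = X Z, then M = A + B *)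
    T_MSO (ALL vX, ALL vY, ALL vZ, ALL vJ, ALL vM, ALL vA, ALL vB,
      (is_join vJ vY vZ /\ is_meet vM vX vJ /\
       is_meet vA vX vY /\ is_meet vB vX vZ ⟹
       is_join vM vA vB))
| T_compl :
    T_MSO (ALL vX, EX vY, EX vZ,
      (is_meet Bot vX vY /\ is_top vZ /\ is_join vZ vX vY))
| T_atomic :
    T_MSO (ALL vX, (~ (vX ≐ Bot) ⟹ EX vY, (is_atom vY /\ vY ⊆ vX)))
| T_at : T_MSO (ALL vX, (FAt vX ⟺ is_atom vX))
| T_bot : T_MSO (ALL vX, Bot ⊆ vX)
| T_prec_irr : T_MSO (ALLAT vx, ~ (vx ≺ vx))
| T_prec_trans :
    T_MSO (ALLAT vx, ALLAT vy, ALLAT vz, (vx ≺ vy /\ vy ≺ vz ⟹ vx ≺ vz))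
| T_prec_total :
    T_MSO (ALLAT vx, ALLAT vy, (vx ≺ vy \/ vx ≐ vy \/ vy ≺ vx))
| T_succ :
    T_MSO (ALLAT vx, ((EXAT vy, vx ≺ vy) ⟹
      EXAT vy, (vx ≺ vy /\ ~ (EXAT vz, (vx ≺ vz /\ vz ≺ vy)))))
| T_pred :
    T_MSO (ALLAT vx, ((EXAT vy, vy ≺ vx) ⟹
      EXAT vy, (vy ≺ vx /\ ~ (EXAT vz, (vy ≺ vz /\ vz ≺ vx)))))
| T_least :
    T_MSO ((EXAT vx, vx ≐ vx) ⟹ EXAT vx, ALLAT vy, (vx ≐ vy \/ vx ≺ vy))
| T_greatest :
    T_MSO ((EXAT vx, vx ≐ vx) ⟹ EXAT vx, ALLAT vy, (vy ≐ vx \/ vy ≺ vx))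
| T_first :
    T_MSO (ALL vX, (~ (vX ≐ Bot) ⟹
      EXAT vx, (vx ⊆ vX /\ ALLAT vy, (vy ⊆ vX ⟹ vx ≐ vy \/ vx ≺ vy))))
| T_prec :
    T_MSO (ALL vX, ALL vY, (vX ≺ vY ⟺
      EXAT vx, EXAT vy, (vx ⊆ vX /\ vy ⊆ vY /\ vx ≺ vy)))
| T_letter_at (a : Sigma) : T_MSO (ALL vX, (FP a vX ⟹ FAt vX))
| T_letter_ex : T_MSO (ALLAT vx, \big[@FOr Sigma/FFalse]_(a : Sigma) FP a vx)
| T_letter_uniq (a b : Sigma) : a != b ->
    T_MSO (ALLAT vx, ~ (FP a vx /\ FP b vx))
| T_comp (p : formula Sigma) (x Z : nat) (Ys : seq nat) :
    uniq [:: x, Z & Ys] -> {subset fv p <= x :: Ys} ->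
    T_MSO (FAlls Ys (EX Z, ALLAT x, (x ⊆ Z ⟺ p))).

Lemma T_MSO_sentence (Sigma : finType) (p : formula Sigma) :
  T_MSO p -> sentence p.
Proof.
have fv_alls (xs : seq nat) (q : formula Sigma) :
  fv (FAlls xs q) = [seq y <- fv q | y \notin xs].
  elim: xs => [|x xs IH] /=; first by rewrite filter_predT.
  rewrite IH -filter_predI; apply: eq_filter => y /=.
  by rewrite inE negb_or.
have nilp_filter (a : pred nat) r : {in r, forall y, ~~ a y} ->
    nilp (filter a r).
  by move=> Na; rewrite /nilp size_filter -leqn0 leqNgt -has_count; apply/hasPn.
case=> // [|q x Z Ys xZYs fvq]; rewrite /sentence.
  set f := bigop _ _ _; have: {subset fv f <= [:: vx]}.
    rewrite /f; elim/big_ind: _ => [//|q r fq fr y /=|a _ y //].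
    by rewrite mem_cat => /orP[/fq|/fr].
  move=> fvf; apply: nilp_filter => y; rewrite negbK mem_cat => /orP[|/fvf].
    by rewrite inE.
  by rewrite inE.
rewrite fv_alls; apply: nilp_filter => y; rewrite negbK.
rewrite mem_filter => /andP[yZ]; rewrite mem_filter => /andP[yx].
rewrite !(mem_cat, inE) (negPf yZ) (negPf yx) /= !orbF orbb => /fvq.
by rewrite inE (negPf yx).
Qed.

(* Main.v *)
Require Import Defs.
From mathcomp Require Import all_boot all_order.
From mathcomp Require Import boolp.

(* That words satisfy the axioms is a direct check.  Conversely let M be a     *)
(* model of the axioms and p a sentence of quantifier depth n.  The n-round    *)
(* type of an initial segment of the positions of M takes finitely many        *)
(* values, is definable in M from the last position of the segment, and, when  *)
(* a position is appended, changes by a function of the letter there which     *)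
(* does not depend on M.  By comprehension the positions whose initial segment *)
(* does not have the type of a finite word form a set of M; a least element of *)
(* that set would have a predecessor (or be the first position) and hence the  *)
(* type of a word extended by one letter.  So M itself has the type of a       *)
(* finite word, and p holds in M because it holds in that word.                *)

Set Implicit Arguments.
Unset Strict Implicit.
Unset Printing Implicit Defensive.

(** For fixed [K] and [n], [type_of K n D f] describes the Ehrenfeucht-Fraïssé game of [n] rounds on
    sets held in [K] variables and seen only through the positions in [D]. Two facts carry the
    proof. By [sat_type], in models of the axioms the type over all atoms determines the truth of
    every formula of width at most [K] and depth at most [n]. By [type_of_step], a composition
    theorem in the style of Feferman and Vaught, adding a last position changes the type by the
    function [type_step] of its letter and of the variables containing it. With every variable at
    bottom, types are thus the states of a finite automaton, [run], that reads the letters.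

    On a finite word the run gives the type at once ([type_of_word]). The order of an arbitrary
    model may be infinite, and induction along it is available for definable properties only:
    [definable_type] supplies definability, and [comprehension] with [least_atom] and [pred_atom]
    the induction in [type_of_model]. The other direction of the theorem is [MSO_T_MSO]. *)

Lemma updE (T : Type) (e : nat -> T) x a : upd e x a x = a.
Proof. by rewrite /upd eqxx. Qed.

Lemma upd_neq (T : Type) (e : nat -> T) x a y : y != x -> upd e x a y = e y.
Proof. by rewrite /upd => /negPf->. Qed.

Lemma upd_id (T : Type) (e : nat -> T) x : upd e x (e x) = e.
Proof. by apply: funext => y; rewrite /upd; case: eqP => [->|]. Qed.

(** * Satisfaction and free variables *)

Section Satisfaction.
Context (Sigma : Type) (M : structure Sigma).

Lemma eval_fv (e e' : nat -> M) (t : term) :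
  {in term_fv t, e =1 e'} -> eval e t = eval e' t.
Proof. by case: t => //= x; apply; rewrite inE. Qed.

Lemma sat_fv (p : formula Sigma) (e e' : nat -> M) :
  {in fv p, e =1 e'} -> sat e p <-> sat e' p.
Proof.
have cat_in (s t : seq nat) (f f' : nat -> M) :
    {in s ++ t, f =1 f'} -> {in s, f =1 f'} /\ {in t, f =1 f'}.
  by move=> ff'; split=> x xs; apply: ff'; rewrite mem_cat xs ?orbT.
have upd_in x (s : seq nat) (f f' : nat -> M) a :
    {in [seq y <- s | y != x], f =1 f'} -> {in s, upd f x a =1 upd f' x a}.
  move=> ff' y ys; rewrite /upd; case: eqP => // /eqP yx.
  by apply: ff'; rewrite mem_filter yx.
elim: p e e' => [|s t|s t|s t|t|a t|p IHp q IHq|p IHp q IHq|p IHp q IHq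
  |x p IHp|x p IHp] e e' //=.
- by case/cat_in=> /eval_fv -> /eval_fv ->.
- by case/cat_in=> /eval_fv -> /eval_fv ->.
- by case/cat_in=> /eval_fv -> /eval_fv ->.
- by move/eval_fv->.
- by move/eval_fv->.
- by case/cat_in=> /IHp Ep /IHq Eq; tauto.
- by case/cat_in=> /IHp Ep /IHq Eq; tauto.
- by case/cat_in=> /IHp Ep /IHq Eq; tauto.
- move=> ee'; split=> H a.
    by apply/(IHp (upd e x a)); [exact: upd_in|exact: H].
  by apply/(IHp _ (upd e' x a)); [exact: upd_in|exact: H].
- move=> ee'; split=> -[a H]; exists a.
    by apply/(IHp (upd e x a)); [exact: upd_in|exact: H].
  by apply/(IHp _ (upd e' x a)); [exact: upd_in|exact: H].
Qed.

Lemma holds_FAlls (xs : seq nat) (p : formula Sigma) :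
  holds M (FAlls xs p) <-> holds M p.
Proof.
elim: xs => [//|x xs IH] /=; rewrite -IH; split=> H e.
  by rewrite -(upd_id e x); exact: H.
by move=> a; exact: H.
Qed.

Lemma sat_bigFOr (I : finType) (p : I -> formula Sigma) (e : nat -> M) :
  sat e (\big[@FOr Sigma/FFalse]_(i : I) p i) <-> exists i, sat e (p i).
Proof.
have -> : sat e (\big[@FOr Sigma/FFalse]_(i : I) p i) <->
    exists2 i, i \in index_enum I & sat e (p i).
  elim: (index_enum I) => [|i s IH]; rewrite ?big_nil ?big_cons /=.
    by split=> // -[].
  rewrite IH; split=> [[pi|[j js pj]]|[j]].
  - by exists i; rewrite ?mem_head.
  - by exists j; rewrite // inE js orbT.
  - by rewrite inE => /orP[/eqP<-|js pj]; [left|right; exists j].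
by split=> [[i _ pi]|[i pi]]; exists i; rewrite ?mem_index_enum.
Qed.

End Satisfaction.

(** * Finite words satisfy the axioms *)

Section WordModel.
Import Order.TTheory.
Local Open Scope order_scope.
Context (Sigma : finType) (w : word Sigma).
Local Notation D := (word_dom w).
Local Notation M := (MSO w).

Lemma MSO_is_atom (X : M) :
  (exists a : D, X = [set a]) <->
  X <> set0 /\ forall U : {set D}, U \subset X -> U = set0 \/ U = X.
Proof.
split=> [[a ->]|[/eqP X0 minX]].
  split=> [/setP/(_ a)|U]; first by rewrite !inE eqxx.
  by rewrite subset1 => /orP[/eqP->|/eqP->]; [right|left].
have [a aX] := set0Pn _ X0; exists a.
by case: (minX [set a]); rewrite ?sub1set // => /setP/(_ a); rewrite !inE eqxx.
Qed.

Lemma MSO_least (A : {set D}) : A != set0 ->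
  exists2 a, a \in A & forall b, b \in A -> a <= b.
Proof. by case/set0Pn=> a0 /(arg_minP id)[a aA amin]; exists a. Qed.

Lemma MSO_greatest (A : {set D}) : A != set0 ->
  exists2 a, a \in A & forall b, b \in A -> b <= a.
Proof. by case/set0Pn=> a0 /(arg_maxP id)[a aA amax]; exists a. Qed.

Lemma MSO_prec1 (a b : D) : s_prec (s:=M) [set a] [set b] <-> a < b.
Proof.
split=> [[x [y]]|ab]; last by exists a, b; rewrite !inE !eqxx.
by rewrite !inE => -[/eqP-> /eqP->].
Qed.

(** The order axioms asking for a neighbour or an extremal position hold because nonempty subsets of
    a finite order have a least and a greatest element; comprehension holds because every set of
    positions belongs to the structure. *)
Lemma MSO_T_MSO : models M (@T_MSO Sigma).
Proof.
move=> p; case=> {p}.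
- by move=> e X /=.
- by move=> e X Y [/= XY YX]; apply/eqP; rewrite eqEsubset XY.
- by move=> e X Y Z [/= XY]; exact: subset_trans.
- move=> e X Y; exists (X :&: Y) => U /=; rewrite !/upd /=.
  by rewrite subsetI; split=> [/andP|?]; [|exact/andP].
- move=> e X Y; exists (X :|: Y) => U /=; rewrite !/upd /=.
  by rewrite subUset; split=> [/andP|?]; [|exact/andP].
- move=> e X Y Z J N A B /= [HJ [HN [HA HB]]].
  have joinE (J' S T : {set D}) :
      (forall U : {set D}, J' \subset U <-> S \subset U /\ T \subset U) ->
      J' = S :|: T.
    move=> H; apply/eqP; rewrite eqEsubset subUset.
    case: (H J') => /(_ (subxx _)) [-> ->] _; rewrite andbT.
    by case: (H (S :|: T)) => _ -> //; rewrite subsetUl subsetUr.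
  have meetE (J' S T : {set D}) :
      (forall U : {set D}, U \subset J' <-> U \subset S /\ U \subset T) ->
      J' = S :&: T.
    move=> H; apply/eqP; rewrite eqEsubset subsetI.
    case: (H J') => /(_ (subxx _)) [-> ->] _.
    by case: (H (S :&: T)) => _ -> //; rewrite subsetIl subsetIr.
  rewrite /upd /= in HJ HN HA HB *.
  rewrite (meetE _ _ _ HN) (joinE _ _ _ HJ) (meetE _ _ _ HA) (meetE _ _ _ HB).
  by move=> U; rewrite setIUr subUset; split=> [/andP|?]; [|exact/andP].
- move=> e X; exists (~: X), setT; rewrite /= /upd /=; split; [|split].
  + move=> U; rewrite -(setICr X) subsetI.
    by split=> [/andP|?]; [|exact/andP].
  + by move=> U; rewrite subsetT.
  + move=> U; rewrite -(setUCr X) subUset.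
    by split=> [/andP|?]; [|exact/andP].
- move=> e X /= X0; rewrite /upd /= in X0 *.
  have /set0Pn[a aX] : X != set0 by apply/eqP.
  exists [set a]; rewrite sub1set; split=> //.
  by apply/MSO_is_atom; exists a.
- move=> e X /=; rewrite /upd /=; split=> [/MSO_is_atom[X0 H]|[X0 H]].
    by split.
  by apply/MSO_is_atom.
- by move=> e X /=; rewrite sub0set.
- move=> e X /= [a]; rewrite updE => -> /= /MSO_prec1.
  by rewrite ltxx.
- move=> e X /= [a]; rewrite /upd /= => -> Y [b ->] Z [c ->] [].
  by move=> /MSO_prec1 ab /MSO_prec1 bc; apply/MSO_prec1; exact: lt_trans bc.
- move=> e X /= [a]; rewrite /upd /= => -> Y [b ->].
  case: (ltgtP a b) => [ab|ba|->]; [left|right; right|right; left] => //;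
    exact/MSO_prec1.
- move=> e X [a]; rewrite /= /upd /= => -> [Y [[b ->] /MSO_prec1 ab]].
  have /MSO_least[c] : [set x | a < x] != set0.
    by apply/set0Pn; exists b; rewrite inE.
  rewrite inE => ac cmin; exists [set c]; split; first by exists c.
  split; first exact/MSO_prec1.
  case=> Z [[d ->] [/MSO_prec1 ad /MSO_prec1 dc]].
  by have := cmin d; rewrite inE => /(_ ad); rewrite leNgt dc.
- move=> e X [a]; rewrite /= /upd /= => -> [Y [[b ->] /MSO_prec1 ab]].
  have /MSO_greatest[c] : [set x | x < a] != set0.
    by apply/set0Pn; exists b; rewrite inE.
  rewrite inE => ac cmin; exists [set c]; split; first by exists c.
  split; first exact/MSO_prec1.
  case=> Z [[d ->] [/MSO_prec1 cd /MSO_prec1 da]].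
  by have := cmin d; rewrite inE => /(_ da); rewrite leNgt cd.
- move=> e [X [[a _] _]].
  have /MSO_least[c _ cmin] : [set: D] != set0 by apply/set0Pn; exists a.
  exists [set c]; split; first by exists c.
  move=> Y [b]; rewrite /= /upd /= => ->.
  have := cmin b (in_setT _); rewrite le_eqVlt.
  case/orP=> [/eqP->|cb]; [left|right] => //.
  exact/MSO_prec1.
- move=> e [X [[a _] _]].
  have /MSO_greatest[c _ cmin] : [set: D] != set0 by apply/set0Pn; exists a.
  exists [set c]; split; first by exists c.
  move=> Y [b]; rewrite /= /upd /= => ->.
  have := cmin b (in_setT _); rewrite le_eqVlt.
  case/orP=> [/eqP->|cb]; [left|right] => //.
  exact/MSO_prec1.
- move=> e X; rewrite /= /upd /= => /eqP/MSO_least[c cX cmin].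
  exists [set c]; split; first by exists c.
  split; first by rewrite sub1set.
  move=> Y [b ->]; rewrite sub1set => /cmin.
  rewrite le_eqVlt => /orP[/eqP->|cb]; [left|right] => //.
  exact/MSO_prec1.
- move=> e X Y; rewrite /= /upd /=; split=> [[a [b [aX bY ab]]]|].
    exists [set a]; split; first by exists a.
    exists [set b]; split; first by exists b.
    by rewrite !sub1set aX bY; split=> //; split=> //; apply/MSO_prec1.
  case=> _ [[a ->] [_ [[b ->] []]]]; rewrite !sub1set => aX [bY /MSO_prec1 ab].
  by exists a, b.
- by move=> a e X [b]; rewrite /= /upd /= => -> _; exists b.
- move=> e X [a]; rewrite [X in X = _]updE => Xa.
  by apply/sat_bigFOr; exists (w a); exists a.
- move=> a b /eqP ab e X [c]; rewrite /= /upd /= => -> [[d /set1_inj<- cb]].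
  by case=> d' /set1_inj<-; rewrite cb.
- move=> p x Z Ys uxZ fvp.
  have {uxZ} [xZ ZYs] : x != Z /\ Z \notin Ys.
    by move: uxZ; rewrite /= inE negb_or -!andbA => /and4P[].
  apply/holds_FAlls => e.
  (* The set is formed under [e], before [Z] receives it as value; this is harmless because [Z] is
     not free in [p]. *)
  pose A : M := [set a | `[< sat (upd e x [set a] : nat -> M) p >]].
  exists A => X [a]; rewrite [eval _ _]updE => {X}->.
  have EA : upd (upd e Z A) x [set a] Z = A.
    by rewrite /upd eq_sym (negPf xZ) eqxx.
  have E : sat (upd e x [set a] : nat -> M) p <->
     sat (upd (upd e Z A) x [set a] : nat -> M) p.
    apply: sat_fv => y /fvp; rewrite inE /upd; case: eqP => //= _.
    by case: eqP ZYs => // -> /negPf->.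
  split; rewrite /= EA updE sub1set inE; first by move/asboolP/E.
  by move/E/asboolP.
Qed.

End WordModel.

(** * Consequences of the axioms *)

Section ModelFacts.
Context (Sigma : finType) (M : structure Sigma).
Context (hM : models M (@T_MSO Sigma)).
Implicit Types (X Y Z U u v : M) (e : nat -> M).
Local Notation sub := (@s_sub Sigma M).
Local Notation prec := (@s_prec Sigma M).
Local Notation atom := (@s_at Sigma M).
Local Notation bot := (s_bot M).
Local Notation e0 := (fun _ : nat => bot).

Lemma subXX X : sub X X.
Proof. exact: (hM (@T_sub_refl _) e0 X). Qed.

Lemma sub_anti X Y : sub X Y -> sub Y X -> X = Y.
Proof. by move=> XY YX; exact: (hM (@T_sub_anti _) e0 X Y (conj XY YX)). Qed.

Lemma sub_trans X Y Z : sub X Y -> sub Y Z -> sub X Z.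
Proof. by move=> XY YZ; exact: (hM (@T_sub_trans _) e0 X Y Z (conj XY YZ)). Qed.

Lemma sub_bot X : sub bot X.
Proof. exact: (hM (@T_bot _) e0 X). Qed.

Lemma atomP X : atom X <->
  X <> bot /\ forall U, sub U X -> U = bot \/ U = X.
Proof. by have [] := hM (@T_at _) e0 X. Qed.

Lemma has_atom X : X <> bot -> exists2 u, atom u & sub u X.
Proof.
by move=> /(hM (@T_atomic _) e0)[u [[u0 minu] uX]]; exists u => //; apply/atomP.
Qed.

Lemma atom_bot u : atom u -> ~ sub u bot.
Proof. by move=> /atomP[u0 _] ub; apply/u0/sub_anti => //; exact: sub_bot. Qed.

Lemma sub_atom u v : atom u -> atom v -> sub u v -> u = v.
Proof. by move=> /atomP[u0 _] /atomP[_ minv] /minv[]. Qed.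

(** An atom below [X] and below a complement of [Y] would lie below bottom; so the meet of [X] with
    that complement has no atom and is bottom. *)
Lemma subP X Y : sub X Y <-> forall u, atom u -> sub u X -> sub u Y.
Proof.
split=> [XY u _ uX|H]; first exact: sub_trans XY.
have [C [T [HC [HT HJ]]]] := hM (@T_compl _) e0 Y.
have [A HA] := hM (@T_meet _) e0 X Y.
have [B HB] := hM (@T_meet _) e0 X C.
rewrite /= /upd /= in HC HT HJ HA HB.
have B0 : B = bot.
  case: (pselect (B = bot)) => // /has_atom[u au uB].
  have [uX uC] := (HB u).1 uB.
  by case: (atom_bot au); apply/HC; split=> //; exact: H.
(* The top [T] is the join of [Y] and its complement [C], so [X] is its own meet with that join.
   Distributivity then makes [X] the join of [A] and [B], where [B] is bottom and [A] is below
   [Y]. *)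
have HX U : sub U X <-> sub U X /\ sub U T.
  by split=> [UX|[]//]; split=> //; exact: HT.
have := hM (@T_distr _) e0 X Y C T X A B.
rewrite /= /upd /= => /(_ (conj HJ (conj HX (conj HA HB)))) /(_ A) [_ XA].
have [_ AY] := (HA A).1 (subXX A); apply: sub_trans AY.
by apply: XA; split; [exact: subXX|rewrite B0; exact: sub_bot].
Qed.

Lemma botP X : X = bot <-> forall u, atom u -> ~ sub u X.
Proof.
split=> [-> u|H]; first exact: atom_bot.
by case: (pselect (X = bot)) => // /has_atom[u au /H-/(_ au)].
Qed.

Lemma prec_irr u : atom u -> ~ prec u u.
Proof. exact: (hM (@T_prec_irr _) e0). Qed.

Lemma prec_trans u v z : atom u -> atom v -> atom z ->
  prec u v -> prec v z -> prec u z.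
Proof.
by move=> au av az uv vz; exact: (hM (@T_prec_trans _) e0 u au v av z az).
Qed.

Lemma prec_total u v : atom u -> atom v -> prec u v \/ u = v \/ prec v u.
Proof. by move=> au av; exact: (hM (@T_prec_total _) e0 u au v av). Qed.

Lemma precP X Y : prec X Y <->
  exists u v, [/\ atom u, atom v, sub u X, sub v Y & prec u v].
Proof.
have [H1 H2] := hM (@T_prec _) e0 X Y; rewrite /= /upd /= in H1 H2.
split=> [/H1[u [au [v [av [uX [vY uv]]]]]]|[u [v [au av uX vY uv]]]].
  by exists u, v.
by apply: H2; exists u; split=> //; exists v.
Qed.

(** Two distinct atoms below [X] would be comparable, which gives [prec X X]. *)
Lemma atom_prec X : atom X <-> X <> bot /\ ~ prec X X.
Proof.
split=> [aX|[/has_atom[u au uX] XX]].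
  by split; [case/atomP: aX|exact: prec_irr].
suff -> : X = u by [].
apply: sub_anti => //; apply/subP => v av vX.
have [uv|[->|vu]] := prec_total au av; last 2 first.
- exact: subXX.
- by case: XX; apply/precP; exists v, u.
- by case: XX; apply/precP; exists u, v.
Qed.

Lemma letter_atom a X : s_P a X -> atom X.
Proof. exact: (hM (@T_letter_at _ a) e0). Qed.

Lemma letter_ex u : atom u -> exists a, s_P a u.
Proof.
by move=> au; have /sat_bigFOr[a] := hM (@T_letter_ex _) e0 u au; exists a.
Qed.

Lemma letter_uniq a b u : s_P a u -> s_P b u -> a = b.
Proof.
move=> ua ub; apply/eqP/negPn/negP => ab.
exact: (hM (T_letter_uniq ab) e0 u (letter_atom ua) (conj ua ub)).
Qed.

Lemma letterP a X : s_P a X <->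
  atom X /\ forall u, atom u -> sub u X -> s_P a u.
Proof.
split=> [Xa|[aX /(_ X aX)]]; last by apply; exact: subXX.
have aX := letter_atom Xa.
by split=> // u au /(sub_atom au aX) ->.
Qed.

Lemma least_atom X : X <> bot -> exists u,
  [/\ atom u, sub u X & forall v, atom v -> sub v X -> u = v \/ prec u v].
Proof.
move=> X0; have [u [au [uX minu]]] := hM (@T_first _) e0 X X0.
by exists u.
Qed.

Lemma greatest_atom u : atom u -> exists2 g, atom g &
  forall v, atom v -> v = g \/ prec v g.
Proof.
move=> au; have [|g [ag H]] := hM (@T_greatest _) e0; first by exists u.
by exists g.
Qed.

Lemma pred_atom u v : atom u -> atom v -> prec v u -> exists y,
  [/\ atom y, prec y u & forall z, atom z -> prec z u -> z = y \/ prec z y].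
Proof.
move=> au av vu.
have [|y [ay [yu H]]] := hM (@T_pred _) e0 u au; first by exists v.
exists y; split=> // z az zu.
have [zy|[->|yz]] := prec_total az ay; [by right|by left|].
by case: H; exists z.
Qed.

(** * Definable properties of environments *)

Definition definable (Q : (nat -> M) -> Prop) :=
  exists p : formula Sigma, forall e, sat e p <-> Q e.

(** The schema in semantic form: the environment [e] supplies the parameters, so no formula has to
    be displayed by its users. *)
Lemma comprehension (Q : (nat -> M) -> Prop) x e : definable Q ->
  exists Z, forall u, atom u -> (sub u Z <-> Q (upd e x u)).
Proof.
case=> p pQ.
(* A variable beyond [x] and all free variables of [p], as the schema requires for the set to be
   formed. *)
pose Z := (\max_(y <- x :: fv p) y).+1.
pose Ys := undup [seq y <- fv p | y != x].
have ltZ y : y \in x :: fv p -> y < Z.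
  by move=> yp; rewrite ltnS; exact: leq_bigmax_seq.
have xZ : x < Z by apply: ltZ; rewrite mem_head.
have uYs : uniq [:: x, Z & Ys].
  rewrite /= inE negb_or (ltn_eqF xZ) undup_uniq !mem_undup !mem_filter eqxx /=.
  rewrite andbT; apply/negP => /andP[_ Zp].
  by have := ltZ Z; rewrite inE Zp orbT ltnn => /(_ isT).
have fvp : {subset fv p <= x :: Ys}.
  by move=> y yp; rewrite inE mem_undup mem_filter yp andbT orbN.
have /holds_FAlls/(_ e)[S HS] := hM (T_comp uYs fvp).
exists S => u au; rewrite -pQ.
have EZ : upd (upd e Z S) x u Z = S by rewrite /upd (gtn_eqF xZ) eqxx.
have := HS u; rewrite /= EZ updE => /(_ au).
have E : sat (upd (upd e Z S) x u) p <-> sat (upd e x u) p.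
  apply: sat_fv => y yp; rewrite /upd; case: eqP => // _.
  by rewrite ltn_eqF // ltZ // inE yp orbT.
by case=> H1 H2; split=> [/H1/E|/E/H2].
Qed.

Lemma definable_iff (Q Q' : (nat -> M) -> Prop) :
  (forall e, Q e <-> Q' e) -> definable Q -> definable Q'.
Proof. by move=> QQ' [p pQ]; exists p => e; rewrite pQ. Qed.

Lemma definable_false : definable (fun=> False).
Proof. by exists FFalse. Qed.

Lemma definable_sub s t : definable (fun e => sub (eval e s) (eval e t)).
Proof. by exists (FSub s t). Qed.

Lemma definable_eq s t : definable (fun e => eval e s = eval e t).
Proof. by exists (FEq s t). Qed.

Lemma definable_imp (Q R : (nat -> M) -> Prop) :
  definable Q -> definable R -> definable (fun e => Q e -> R e).
Proof. by move=> [q qQ] [r rR]; exists (FImp q r) => e /=; rewrite qQ rR. Qed.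

Lemma definable_and (Q R : (nat -> M) -> Prop) :
  definable Q -> definable R -> definable (fun e => Q e /\ R e).
Proof. by move=> [q qQ] [r rR]; exists (FAnd q r) => e /=; rewrite qQ rR. Qed.

Lemma definable_or (Q R : (nat -> M) -> Prop) :
  definable Q -> definable R -> definable (fun e => Q e \/ R e).
Proof. by move=> [q qQ] [r rR]; exists (FOr q r) => e /=; rewrite qQ rR. Qed.

Lemma definable_not (Q : (nat -> M) -> Prop) :
  definable Q -> definable (fun e => ~ Q e).
Proof. by move=> dQ; apply: definable_imp dQ definable_false. Qed.

Lemma definable_iffb (Q : (nat -> M) -> Prop) (b : bool) :
  definable Q -> definable (fun e => Q e <-> b).
Proof.
case: b => dQ.
  by apply: definable_iff _ dQ => e; split=> [q|[_ H]]; [split|exact: H].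
by apply: definable_iff _ (definable_not dQ) => e; split=> [nQ|[H _] /H//].
Qed.

Lemma definable_ex x (Q : (nat -> M) -> Prop) :
  definable Q -> definable (fun e => exists X, Q (upd e x X)).
Proof.
move=> [q qQ]; exists (FEx x q) => e /=.
by split=> -[X] /qQ; exists X.
Qed.

Lemma definable_fin_ex (I : finType) (Q : I -> (nat -> M) -> Prop) :
  (forall i, definable (Q i)) -> definable (fun e => exists i, Q i e).
Proof.
move=> /choice[q qQ]; exists (\big[@FOr Sigma/FFalse]_i q i) => e.
by rewrite sat_bigFOr; split=> -[i /qQ]; exists i.
Qed.

Lemma definable_fin_all (I : finType) (Q : I -> (nat -> M) -> Prop) :
  (forall i, definable (Q i)) -> definable (fun e => forall i, Q i e).
Proof.
move=> dQ.
have := definable_not (definable_fin_ex (fun i => definable_not (dQ i))).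
apply: definable_iff => e; split=> [H i|H [i]]; last by apply.
by apply: contrapT => nQ; apply: H; exists i.
Qed.

End ModelFacts.

(** * Ehrenfeucht-Fraïssé types over a set of positions *)

Section Types.
Context (Sigma : finType) (K : nat).

(* These facts determine [At] and [P]: as positions are linearly ordered, X is *)
(* an atom iff it is not empty and [X ≺ X] fails.                              *)
Definition fact : finType :=
  ('I_K * 'I_K + 'I_K * 'I_K + Sigma * 'I_K + 'I_K)%type.
Definition sub_fact (i j : 'I_K) : fact := inl (inl (inl (i, j))).
Definition prec_fact (i j : 'I_K) : fact := inl (inl (inr (i, j))).
Definition letter_fact (a : Sigma) (i : 'I_K) : fact := inl (inr (a, i)).
Definition empty_fact (i : 'I_K) : fact := inr i.

(** A move reassigns one of the [K] variables instead of adding a new one, so types match formulas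
    whose variables may be rebound. Being a [finType], [typ n] allows finite disjunctions over all
    types. *)
Fixpoint typ (n : nat) : finType :=
  if n is n'.+1 then ({set fact} * {set 'I_K * typ n'})%type else {set fact}.

Definition factP (M : structure Sigma) (D : M -> Prop) (f : nat -> M)
    (q : fact) : Prop :=
  match q with
  | inl (inl (inl (i, j))) => forall u, D u -> s_sub u (f i) -> s_sub u (f j)
  | inl (inl (inr (i, j))) => exists u v,
      [/\ D u, D v, s_sub u (f i), s_sub v (f j) & s_prec u v]
  | inl (inr (a, i)) => forall u, D u -> s_sub u (f i) -> s_P a u
  | inr i => forall u, D u -> ~ s_sub u (f i)
  end.

Fixpoint type_of n (M : structure Sigma) (D : M -> Prop) (f : nat -> M) :
    typ n :=
  match n return typ n with
  | 0 => [set q | `[< factP D f q >]]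
  | n'.+1 => ([set q | `[< factP D f q >]],
      [set p : 'I_K * typ n' |
        `[< exists X, type_of n' D (upd f p.1 X) = p.2 >]])
  end.

Definition same_trace (M : structure Sigma) (D : M -> Prop) (f g : nat -> M) :=
  forall i, i < K -> forall u, D u -> (s_sub u (f i) <-> s_sub u (g i)).

Lemma same_trace_sym (M : structure Sigma) (D : M -> Prop) (f g : nat -> M) :
  same_trace D f g -> same_trace D g f.
Proof. by move=> fg i iK u Du; apply: iff_sym; exact: fg. Qed.

Lemma same_trace_upd (M : structure Sigma) (D : M -> Prop) (f g : nat -> M)
    x X :
  same_trace D f g -> same_trace D (upd f x X) (upd g x X).
Proof. by move=> fg i iK u Du; rewrite /upd; case: eqP => // _; exact: fg. Qed.

Lemma factP_trace (M : structure Sigma) (D : M -> Prop) (f g : nat -> M) q :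
  same_trace D f g -> factP D f q -> factP D g q.
Proof.
move=> fg; have fgi (i : 'I_K) := fg i (ltn_ord i).
case: q => [[[[i j]|[i j]]|[a i]]|i] /=.
- by move=> H u Du /(fgi i u Du) /(H u Du) /(fgi j u Du).
- case=> u [v [Du Dv /(fgi i u Du) ui /(fgi j v Dv) vj uv]].
  by exists u, v.
- by move=> H u Du /(fgi i u Du) /(H u Du).
- by move=> H u Du /(fgi i u Du) /(H u Du).
Qed.

(** Facts inspect only variables below [K], and only through positions in [D]; any further set may
    be played identically on both sides. Hence sets may be altered outside [D], and variable [K]
    reset, without changing the type. *)
Lemma type_of_trace n (M : structure Sigma) (D : M -> Prop) (f g : nat -> M) :
  same_trace D f g -> type_of n D f = type_of n D g.
Proof.
have facts (f' g' : nat -> M) : same_trace D f' g' ->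
    [set q | `[< factP D f' q >]] = [set q | `[< factP D g' q >]].
  move=> fg; apply/setP => q; rewrite !inE; apply: asbool_equiv_eq.
  by split; apply: factP_trace => //; exact: same_trace_sym.
elim: n f g => [|n IHn] f g fg /=; first exact: facts.
congr (_, _); first exact: facts.
apply/setP => -[i t]; rewrite !inE /=; apply: asbool_equiv_eq.
split=> -[X <-]; exists X; apply: IHn; apply: same_trace_upd => //.
exact: same_trace_sym.
Qed.

(** Over no positions, the universal facts hold vacuously and the existential ones, those about
    precedence, fail. *)
Definition empty_facts : {set fact} :=
  [set q : fact | if q is inl (inl (inr _)) then false else true].

Fixpoint empty_type n : typ n :=
  match n return typ n with
  | 0 => empty_facts
  | n'.+1 => (empty_facts, [set p | p.2 == empty_type n'])
  end.

Lemma type_of_empty n (M : structure Sigma) (D : M -> Prop) (f : nat -> M) :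
  (forall u, ~ D u) -> type_of n D f = empty_type n.
Proof.
move=> D0.
have facts g : [set q | `[< factP D g q >]] = empty_facts.
  apply/setP => q; rewrite !inE.
  case: q => [[[[i j]|[i j]]|[a i]]|i] /=; last 2 first.
  - by apply/asboolP => u /D0.
  - by apply/asboolP => u /D0.
  - by apply/asboolP => u /D0.
  - by apply/asboolP => -[u [v [/D0]]].
elim: n f => [|n IHn] f /=; rewrite facts //; congr (_, _).
apply/setP => -[i t]; rewrite !inE /=.
apply/asboolP/eqP => [[X <-]|->]; first exact: IHn.
by exists (s_bot M); exact: IHn.
Qed.

(* Appending a position with letter [a] that lies exactly in the sets [i] with *)
(* [b i] changes types by a map which is independent of the structure.         *)
Definition fact_step (a : Sigma) (b : nat -> bool) (t : {set fact}) (q : fact) :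
    bool :=
  match q with
  | inl (inl (inl (i, j))) => (q \in t) && (b i ==> b j)
  | inl (inl (inr (i, j))) => (q \in t) || (b j && (empty_fact i \notin t))
  | inl (inr (c, i)) => (q \in t) && (b i ==> (c == a))
  | inr i => (q \in t) && ~~ b i
  end.

Fixpoint type_step n (a : Sigma) (b : nat -> bool) : typ n -> typ n :=
  match n return typ n -> typ n with
  | 0 => fun t => [set q | fact_step a b t q]
  | n'.+1 => fun t => ([set q | fact_step a b t.1 q],
      [set p : 'I_K * typ n' | [exists s : typ n', [exists v : bool,
        ((p.1, s) \in t.2) && (p.2 == type_step a (upd b p.1 v) s)]]])
  end.

(** * Appending a last position *)

Section Step.
Context (M : structure Sigma) (hM : models M (@T_MSO Sigma)).

(** Membership of a single position can be prescribed without disturbing the others; this makes the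
    two choices in [type_step] independent. *)
Lemma set_membership (x X : M) (v : bool) : s_at x -> exists Y,
  (forall u, s_at u -> u <> x -> (s_sub u X <-> s_sub u Y)) /\
  (s_sub x Y <-> v).
Proof.
move=> ax.
(* Variable 0 is the candidate position, 1 holds [X] and 2 holds [x]. When [e 0 = e 2], the negated
   equivalence says exactly [v]. *)
pose Q (e : nat -> M) :=
  (s_sub (e 0) (e 1) /\ e 0 <> e 2) \/ (e 0 = e 2 /\ ~ (e 0 = e 2 <-> ~~ v)).
have dQ : definable Q.
  have d01 := definable_sub M 0 1; have d02 := definable_eq M 0 2.
  apply: definable_or; first by apply: definable_and d01 (definable_not d02).
  by apply: definable_and d02 (definable_not (definable_iffb _ d02)).
have [Y HY] := comprehension hM 0 (upd (upd (fun=> s_bot M) 1 X) 2 x) dQ.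
exists Y; split=> [u au ux|]; rewrite HY // /Q /upd /=.
  by split=> [uX|[[]|[]]//]; left.
case: v {Q dQ HY} => /=; split=> //; last first.
- by case=> [[]//|[_ []]].
- by move=> _; right; split=> // -[/(_ erefl)].
Qed.

Context (D D' : M -> Prop) (x : M) (a : Sigma).
Context (Dat : forall u, D u -> s_at u) (xa : s_P a x).
Context (D'E : forall u, D' u <-> D u \/ u = x).
Context (Dx : forall u, D u -> s_prec u x).

(** Since [x] comes after all of [D], the only new precedences are from a position in [D] to [x];
    they need the first set to meet [D] and the second to contain [x]. *)
Lemma fact_step_correct (f : nat -> M) (q : fact) :
  factP D' f q <->
  fact_step a (fun i => `[< s_sub x (f i) >]) [set q | `[< factP D f q >]] q.
Proof.
have ax := letter_atom hM xa.
have D'x : D' x by apply/D'E; right.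
have DD' u : D u -> D' u by move=> Du; apply/D'E; left.
have nxu u : D' u -> ~ s_prec x u.
  case/D'E=> [Du xu|->]; last exact: (prec_irr hM).
  by apply: (prec_irr hM ax); exact: (prec_trans hM ax (Dat Du) ax xu (Dx Du)).
case: q => [[[[i j]|[i j]]|[c i]]|i]; rewrite /= inE.
- split=> [H|/andP[/asboolP H /implyP Hx] u /D'E[Du|->]]; last 2 first.
  + exact: H.
  + by move=> /asboolP/Hx/asboolP.
  apply/andP; split; first by apply/asboolP => u /DD'; exact: H.
  by apply/implyP => /asboolP xi; apply/asboolP; exact: H.
- split=> [[u [v [D'u /D'E[Dv|->] ui vj uv]]]|].
  + case/D'E: (D'u) => [Du|ux]; last first.
      by case: (nxu v); rewrite -?ux //; exact: DD'.
    by apply/orP; left; apply/asboolP; exists u, v.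
  + case/D'E: (D'u) => [Du|ux]; last by case: (nxu x) => //; rewrite -{1}ux.
    apply/orP; right; apply/andP; split; first exact/asboolP.
    by rewrite inE; apply/asboolP => /(_ u Du).
  + case/orP=> [/asboolP[u [v [Du Dv ui vj uv]]]|/andP[/asboolP xj]].
      by exists u, v; split=> //; exact: DD'.
    rewrite inE => /asboolP /existsNP[u /not_implyP[Du /contrapT ui]].
    by exists u, x; split=> //; [exact: DD'|exact: Dx].
- split=> [H|/andP[/asboolP H /implyP Hx] u /D'E[Du|->]]; last 2 first.
  + exact: H.
  + by move=> /asboolP/Hx/eqP->.
  apply/andP; split; first by apply/asboolP => u /DD'; exact: H.
  apply/implyP => /asboolP /(H x D'x) xc; apply/eqP.
  exact: (letter_uniq hM xc xa).
- split=> [H|/andP[/asboolP H /asboolP Hx] u /D'E[Du|->//]]; last exact: H.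
  apply/andP; split; first by apply/asboolP => u /DD'; exact: H.
  by apply/asboolP; exact: H.
Qed.

(** By induction on the rounds: a move over [D'] is a move over [D] together with a bit for [x], and
    every such pair is realised by some set. *)
Lemma type_of_step n (f : nat -> M) :
  type_of n D' f = type_step a (fun i => `[< s_sub x (f i) >]) (type_of n D f).
Proof.
have facts g : [set q | `[< factP D' g q >]] =
    [set q | fact_step a (fun i => `[< s_sub x (g i) >])
      [set q | `[< factP D g q >]] q].
  by apply/setP => q; rewrite !inE; apply/asboolP/idP => /fact_step_correct.
elim: n f => [|n IHn] f /=; first exact: facts.
congr (_, _); first exact: facts.
have updb i X : upd (fun j => `[< s_sub x (f j) >]) i `[< s_sub x X >] =
    (fun j => `[< s_sub x (upd f i X j) >]).
  by apply: funext => j; rewrite /upd; case: eqP.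
apply/setP => -[i t]; rewrite !inE /=; apply/asboolP/existsP.
  case=> X <-; exists (type_of n D (upd f i X)).
  apply/existsP; exists `[< s_sub x X >]; rewrite inE updb IHn eqxx andbT.
  by apply/asboolP; exists X.
case=> s /existsP[v /andP[]]; rewrite inE => /asboolP[X /= <-] /eqP->.
(* [X] realises the type [s] over [D] but may have the wrong bit at [x]; [Y] corrects it and has the
   same trace on [D]. *)
have [Y [YX xY]] := set_membership X v (letter_atom hM xa).
exists Y; rewrite IHn -updb (asbool_equiv_eq xY) asboolb; congr type_step.
apply: type_of_trace => j _ u Du; rewrite /upd; case: eqP => // _.
apply: iff_sym; apply: YX; first exact: Dat.
by move=> ux; apply: (prec_irr hM (Dat Du)); rewrite {2}ux; exact: Dx.
Qed.

End Step.

End Types.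

(** * Definability of types from the cut point *)

Section Definability.
Context (Sigma : finType) (K : nat) (M : structure Sigma).

(* Types involve the variables below [K] only, so variable [K] is free to hold *)
(* the cut point.                                                              *)
Definition below (c u : M) : Prop := s_at u /\ ~ s_prec c u.

Lemma definable_fact (q : fact Sigma K) :
  definable (fun e : nat -> M => factP (below (e K)) e q).
Proof.
have neq1 (i : 'I_K) : (i : nat) != K.+1 by rewrite ltn_eqF // ltnS ltnW.
have neq2 (i : 'I_K) : (i : nat) != K.+2.
  by rewrite ltn_eqF // ltnS ltnW // ltnS ltnW.
have K1 : K != K.+1 by rewrite ltn_eqF.
have K2 : K != K.+2 by rewrite ltn_eqF.
have K12 : K.+1 != K.+2 by rewrite ltn_eqF.
(* The bound variables [K.+1] and [K.+2] for positions avoid both the cut point and the variables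
   below [K]. *)
pose le (x : nat) : formula Sigma := FAnd (FAt x) (FNot (FPrec K x)).
case: q => [[[[i j]|[i j]]|[a i]]|i] /=.
- exists (FAll K.+1 (FImp (le K.+1) (FImp (FSub K.+1 i) (FSub K.+1 j)))) => e /=.
  by split=> H u; have := H u; rewrite !updE !upd_neq.
- exists (FEx K.+1 (FEx K.+2 (FAnd (le K.+1) (FAnd (le K.+2)
    (FAnd (FSub K.+1 i) (FAnd (FSub K.+2 j) (FPrec K.+1 K.+2))))))) => e /=.
  split=> -[u [v H]]; exists u, v; move: H.
    by rewrite !updE !(upd_neq _ _ K12) !updE !upd_neq // => -[? [? [? []]]].
  by rewrite !updE !(upd_neq _ _ K12) !updE !upd_neq // => -[].
- exists (FAll K.+1 (FImp (le K.+1) (FImp (FSub K.+1 i) (FP a K.+1)))) => e /=.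
  by split=> H u; have := H u; rewrite !updE !upd_neq.
- exists (FAll K.+1 (FImp (le K.+1) (FNot (FSub K.+1 i)))) => e /=.
  by split=> H u; have := H u; rewrite !updE !upd_neq.
Qed.

(** These are the Hintikka formulas: finitely many facts and finitely many smaller types, each
    required to occur or not to occur. Moves rebind variables below [K], so the cut point stays
    fixed. *)
Lemma definable_type n (t : typ Sigma K n) :
  definable (fun e : nat -> M => type_of K n (below (e K)) e = t).
Proof.
have facts (s : {set fact Sigma K}) :
    definable (fun e : nat -> M =>
      [set q | `[< factP (below (e K)) e q >]] = s).
  have := definable_fin_all (fun q =>
    definable_iffb (q \in s) (definable_fact q)).
  apply: definable_iff => e; split=> [H|<- q].
    by apply/setP => q; rewrite inE; apply/asboolP/idP => /H.
  by rewrite inE; split=> /asboolP.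
elim: n t => [|n IHn] t /=; first exact: facts.
case: t => s r.
have dr (p : 'I_K * typ Sigma K n) := definable_iffb (p \in r)
  (definable_ex p.1 (IHn p.2)).
have := definable_and (facts s) (definable_fin_all dr).
have cut (e : nat -> M) (i : 'I_K) X : upd e i X K = e K.
  by rewrite upd_neq // gtn_eqF.
apply: definable_iff => e; split=> [[<- H]|[<- <-]].
  congr (_, _); apply/setP => p; rewrite inE.
  apply/asboolP/idP => [[X HX]|/H[X]].
    by apply/H; exists X; rewrite cut.
  by rewrite cut; exists X.
split=> // p; rewrite inE; split=> [[X]|/asboolP[X HX]].
  by rewrite cut => HX; apply/asboolP; exists X.
by exists X; rewrite cut.
Qed.

End Definability.

(** * Types determine truth *)

Section Transfer.
Context (Sigma : finType).

(* Variable [x] is numbered [x.+1] in types; the number 0 stands for [Bot].    *)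
Definition term_index (t : term) : nat := if t is Var x then x.+1 else 0.

Definition bot_env (M : structure Sigma) (e : nat -> M) : nat -> M :=
  fun i => if i is x.+1 then e x else s_bot M.

(** A strict bound on the indices used: variable [x] has index [x.+1], so binding it requires [x.+2]
    slots. *)
Fixpoint width (p : formula Sigma) : nat :=
  match p with
  | FFalse => 0
  | FEq s t | FSub s t | FPrec s t => maxn (term_index s).+1 (term_index t).+1
  | FAt t | FP _ t => (term_index t).+1
  | FImp q r | FAnd q r | FOr q r => maxn (width q) (width r)
  | FAll x q | FEx x q => maxn x.+2 (width q)
  end.

Fixpoint depth (p : formula Sigma) : nat :=
  match p with
  | FImp q r | FAnd q r | FOr q r => maxn (depth q) (depth r)
  | FAll _ q | FEx _ q => (depth q).+1
  | _ => 0
  end.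

Lemma eval_bot_env (M : structure Sigma) (e : nat -> M) (t : term) :
  eval e t = bot_env e (term_index t).
Proof. by case: t. Qed.

Lemma bot_env_upd (M : structure Sigma) (e : nat -> M) x X :
  bot_env (upd e x X) = upd (bot_env e) x.+1 X.
Proof. by apply: funext => -[|y]; rewrite /upd //= eqSS. Qed.

Lemma type_fact K n (M N : structure Sigma) (D : M -> Prop) (E : N -> Prop) f g
    (q : fact Sigma K) :
  type_of K n D f = type_of K n E g -> factP D f q <-> factP E g q.
Proof.
have facts : [set r : fact Sigma K | `[< factP D f r >]] =
    [set r | `[< factP E g r >]] -> factP D f q <-> factP E g q.
  by move=> /setP/(_ q); rewrite !inE => H; exact: asbool_eq_equiv H.
by case: n => [|n] /=; [exact: facts|case=> /facts].
Qed.

(** The forth property of the game; the back property is the same statement for the reversed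
    equation. *)
Lemma type_ex K n (M N : structure Sigma) (D : M -> Prop) (E : N -> Prop) f g
    (i : 'I_K) (X : M) :
  type_of K n.+1 D f = type_of K n.+1 E g ->
  exists Y, @type_of Sigma K n M D (upd f i X) = type_of K n E (upd g i Y).
Proof.
case=> _ /setP/(_ (i, type_of K n D (upd f i X))); rewrite !inE /=.
set P := asbool (exists Y : M, _); have -> : P by apply/asboolP; exists X.
by move=> /esym/asboolP[Y HY]; exists Y.
Qed.

Section Facts.
Context (K : nat) (M : structure Sigma) (hM : models M (@T_MSO Sigma)).
Context (e : nat -> M).
Local Notation holds_fact := (factP (@s_at Sigma M) (bot_env e)).

Lemma sat_sub_fact s t (sK : term_index s < K) (tK : term_index t < K) :
  s_sub (eval e s) (eval e t) <->
  holds_fact (sub_fact Sigma (Ordinal sK) (Ordinal tK)).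
Proof. by rewrite !eval_bot_env; exact: subP. Qed.

Lemma sat_eq_fact s t (sK : term_index s < K) (tK : term_index t < K) :
  eval e s = eval e t <->
  holds_fact (sub_fact Sigma (Ordinal sK) (Ordinal tK)) /\
  holds_fact (sub_fact Sigma (Ordinal tK) (Ordinal sK)).
Proof.
rewrite -!sat_sub_fact.
by split=> [->|[]]; [split; exact: (subXX hM)|exact: (sub_anti hM)].
Qed.

Lemma sat_prec_fact s t (sK : term_index s < K) (tK : term_index t < K) :
  s_prec (eval e s) (eval e t) <->
  holds_fact (prec_fact Sigma (Ordinal sK) (Ordinal tK)).
Proof. by rewrite !eval_bot_env; exact: precP. Qed.

Lemma sat_atom_fact t (tK : term_index t < K) :
  s_at (eval e t) <->
  ~ holds_fact (empty_fact Sigma (Ordinal tK)) /\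
  ~ holds_fact (prec_fact Sigma (Ordinal tK) (Ordinal tK)).
Proof. by rewrite -sat_prec_fact (atom_prec hM) (botP hM) eval_bot_env. Qed.

Lemma sat_letter_fact a t (tK : term_index t < K) :
  s_P a (eval e t) <->
  s_at (eval e t) /\ holds_fact (letter_fact a (Ordinal tK)).
Proof. by rewrite (letterP hM) eval_bot_env. Qed.

End Facts.

(** Over all atoms of a model, atomic formulas are Boolean combinations of facts. Each quantifier
    uses up one round, answered by [type_ex]. *)
Lemma sat_type K n (p : formula Sigma) (M N : structure Sigma) e e' :
  models M (@T_MSO Sigma) -> models N (@T_MSO Sigma) ->
  width p <= K -> depth p <= n ->
  type_of K n (@s_at Sigma M) (bot_env e)
    = type_of K n (@s_at Sigma N) (bot_env e') ->
  sat e p <-> sat e' p.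
Proof.
move=> hM hN.
elim: p n e e' => [|s t|s t|s t|t|a t|p IHp q IHq|p IHp q IHq|p IHp q IHq
  |x p IHp|x p IHp] n e e' /=.
- by [].
- rewrite geq_max => /andP[sK tK] _ E.
  rewrite (sat_eq_fact hM _ sK tK) (sat_eq_fact hN _ sK tK).
  by rewrite !(type_fact _ E).
- rewrite geq_max => /andP[sK tK] _ E.
  rewrite (sat_sub_fact hM _ sK tK) (sat_sub_fact hN _ sK tK).
  exact: type_fact E.
- rewrite geq_max => /andP[sK tK] _ E.
  rewrite (sat_prec_fact hM _ sK tK) (sat_prec_fact hN _ sK tK).
  exact: type_fact E.
- move=> tK _ E; rewrite (sat_atom_fact hM _ tK) (sat_atom_fact hN _ tK).
  by rewrite !(type_fact _ E).
- move=> tK _ E.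
  rewrite (sat_letter_fact hM _ _ tK) (sat_letter_fact hN _ _ tK).
  rewrite (sat_atom_fact hM _ tK) (sat_atom_fact hN _ tK).
  by rewrite !(type_fact _ E).
- rewrite !geq_max => /andP[wp wq] /andP[dp dq] E.
  by rewrite (IHp _ _ _ wp dp E) (IHq _ _ _ wq dq E).
- rewrite !geq_max => /andP[wp wq] /andP[dp dq] E.
  by rewrite (IHp _ _ _ wp dp E) (IHq _ _ _ wq dq E).
- rewrite !geq_max => /andP[wp wq] /andP[dp dq] E.
  by rewrite (IHp _ _ _ wp dp E) (IHq _ _ _ wq dq E).
- rewrite geq_max => /andP[xK wp]; case: n => // n; rewrite ltnS => dp E.
  split=> H X.
    have [Y HY] := type_ex (Ordinal xK) X (esym E).
    by apply/(IHp n (upd e x Y)); rewrite ?bot_env_upd //; exact: esym HY.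
  have [Y HY] := type_ex (Ordinal xK) X E.
  by apply/(IHp n _ (upd e' x Y)); rewrite ?bot_env_upd.
- rewrite geq_max => /andP[xK wp]; case: n => // n; rewrite ltnS => dp E.
  split=> -[X H].
    have [Y HY] := type_ex (Ordinal xK) X E.
    by exists Y; apply/(IHp n (upd e x X)); rewrite ?bot_env_upd.
  have [Y HY] := type_ex (Ordinal xK) X (esym E); exists Y.
  by apply/(IHp n _ (upd e' x X)); rewrite ?bot_env_upd //; exact: esym HY.
Qed.

End Transfer.

(** * Every model has the type of a finite word *)

Section Words.
Context (Sigma : finType) (K n : nat).

Definition word_of (s : seq Sigma) : word Sigma :=
  Word (fun i : 'I_(size s) => tnth (in_tuple s) i).

(** The bits are constantly false because all variables hold bottom, which contains no position. *)
Definition run (s : seq Sigma) : typ Sigma K n :=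
  foldl (fun t a => type_step a (fun=> false) t) (empty_type Sigma K n) s.

Lemma run_rcons s a : run (rcons s a) = type_step a (fun=> false) (run s).
Proof. by rewrite /run foldl_rcons. Qed.

Lemma type_of_step_bot (M : structure Sigma) (D D' : M -> Prop) (x : M) a :
  models M (@T_MSO Sigma) -> (forall u, D u -> s_at u) -> s_P a x ->
  (forall u, D' u <-> D u \/ u = x) -> (forall u, D u -> s_prec u x) ->
  type_of K n D' (fun=> s_bot M)
    = type_step a (fun=> false) (@type_of Sigma K n M D (fun=> s_bot M)).
Proof.
move=> hM Dat xa D'E Dx; rewrite (type_of_step K hM Dat xa D'E Dx).
congr type_step; apply: funext => i; apply: asboolF.
exact: (atom_bot hM (letter_atom hM xa)).
Qed.

Lemma type_of_word (s : seq Sigma) :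
  type_of K n (@s_at _ (MSO (word_of s))) (fun=> s_bot (MSO (word_of s)))
    = run s.
Proof.
have hW := @MSO_T_MSO _ (word_of s).
pose D k (u : MSO (word_of s)) := exists2 i : 'I_(size s), u = [set i] & i < k.
suff H k : k <= size s ->
    type_of K n (D k) (fun=> s_bot (MSO (word_of s))) = run (take k s).
  have := H _ (leqnn _); rewrite take_size => <-.
  congr (type_of K n _ _); apply: funext => u; apply: propext.
  by split=> [[i ->]|[i ->]]; exists i => //=.
elim: k => [_|k IHk ks].
  by rewrite take0; apply: type_of_empty => u [].
pose a := tnth (in_tuple s) (Ordinal ks).
rewrite (take_nth a ks) run_rcons -IHk; last exact: ltnW.
apply: (@type_of_step_bot _ (D k) (D k.+1) [set Ordinal ks] _ hW).
- by move=> u [i -> _]; exists i.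
- by exists (Ordinal ks); rewrite // /= (tnth_nth a).
- move=> u; split=> [[i ->]|[[i -> ik]|->]].
  + rewrite ltnS leq_eqVlt => /orP[/eqP ik|ik]; [right|left; by exists i].
    by congr [set _]; exact: val_inj.
  + by exists i => //; exact: ltnW.
  + by exists (Ordinal ks).
- by move=> u [i -> ik]; apply/MSO_prec1.
Qed.

Lemma type_of_model (M : structure Sigma) : models M (@T_MSO Sigma) ->
  exists s, type_of K n (@s_at _ M) (fun=> s_bot M) = run s.
Proof.
move=> hM.
have belowE (c : M) : s_at c -> forall u, below c u -> u = c \/ s_prec u c.
  move=> ac u [au ncu].
  by have [?|[?|?]] := prec_total hM au ac; [right|left|].
pose good (c : M) := exists s, type_of K n (below c) (fun=> s_bot M) = run s.
have step (c : M) (D : M -> Prop) s : s_at c -> (forall u, D u -> s_at u) ->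
    (forall u, below c u <-> D u \/ u = c) -> (forall u, D u -> s_prec u c) ->
    type_of K n D (fun=> s_bot M) = run s -> good c.
  move=> ac Dat cE Dc Ds; have [a ca] := letter_ex hM ac.
  exists (rcons s a); rewrite run_rcons -Ds.
  exact: (type_of_step_bot hM Dat ca cE Dc).
have all_good (c : M) : s_at c -> good c.
  have dgood : definable (fun e : nat -> M =>
      ~ exists t : typ Sigma K n, (exists s, run s = t) /\
        type_of K n (below (e K)) e = t).
    apply/definable_not/definable_fin_ex => t.
    (* Whether some word has type [t] does not depend on the environment, so it is decided outside
       [M]; only the finite disjunction over [t] enters the formula. *)
    have [[s <-]|nt] := pselect (exists s, run s = t).
      apply: (definable_iff _ (definable_type M (run s))) => e.
      by split=> [?|[]//]; split=> //; exists s.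
    by apply: (definable_iff _ (definable_false M)) => e; split=> // -[/nt].
  have [B HB] := comprehension hM K (fun=> s_bot M) dgood.
  have badE (u : M) : s_at u -> s_sub u B <-> ~ good u.
    move=> au; rewrite HB // updE.
    have -> : type_of K n (below u) (upd (fun=> s_bot M) K u) =
        type_of K n (below u) (fun=> s_bot M) :> typ Sigma K n.
      by apply: type_of_trace => i iK v _; rewrite upd_neq // ltn_eqF.
    split=> H G; apply: H.
      by case: G => s ->; exists (run s); split=> //; exists s.
    by case: G => t [[s <-] us]; exists s.
  have [B0 ac|/(least_atom hM)[b [ab bB bmin]]] := pselect (B = s_bot M).
    apply: contrapT => /(badE c ac); rewrite B0; exact: atom_bot.
  case: ((badE b ab).1 bB).
  (* A first position [b] extends the empty segment; otherwise [b] extends the segment of its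
     predecessor, which is good by minimality. Either way [b] is good, contradicting its choice. *)
  have [[v [av vb]]|nv] := pselect (exists v, s_at v /\ s_prec v b); last first.
    apply: (step b (fun=> False) [::]) => //; last first.
      by apply: type_of_empty => u [].
    move=> u; split=> [ub|[//|->]]; last by split=> //; exact: (prec_irr hM).
    right; have [//|ub'] := belowE b ab u ub.
    by case: nv; exists u; split=> //; case: ub.
  have [y [ay yb ymax]] := pred_atom hM ab av vb.
  have [s ys] : good y.
    apply: contrapT => /(badE y ay)/(bmin y ay)[by_|by_].
      by case: (prec_irr hM ab); rewrite {1}by_.
    by case: (prec_irr hM ab); exact: prec_trans by_ yb.
  apply: (step b (below y) s) => //.
  - by move=> u [].
  - move=> u; split=> [ub|[[au nyu]|->]].
    + have [->|ub'] := belowE b ab u ub; [by right|left].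
      have au : s_at u by case: ub.
      split=> // yu; have [uy|uy] := ymax u au ub'.
        by case: (prec_irr hM ay); rewrite uy in yu.
      by case: (prec_irr hM ay); exact: prec_trans yu uy.
    + split=> // bu; apply: nyu; exact: prec_trans bu.
    + by split=> //; exact: (prec_irr hM).
  - move=> u uy; have au : s_at u by case: uy.
    have [->//|uy'] := belowE y ay u uy.
    exact: prec_trans uy' yb.
have [[c ac]|nc] := pselect (exists c : M, s_at c); last first.
  by exists [::]; apply: type_of_empty => u au; apply: nc; exists u.
(* The segment up to the greatest atom consists of all atoms. *)
have [g ag gmax] := greatest_atom hM ac.
have [s gs] := all_good g ag; exists s; rewrite -gs.
congr (type_of K n _ _); apply: funext => u; apply: propext; split=> [au|[]//].
split=> // gu; have [ug|ug] := gmax u au; apply: (prec_irr hM ag).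
  by rewrite ug in gu.
exact: prec_trans gu ug.
Qed.

End Words.

Theorem theorem3p15 (Sigma : finType) (M : structure Sigma) :
  models M (@T_MSO Sigma) <-> models M (@Th_MSO_words Sigma).
Proof.
split=> [hM p Wp e|hM p Tp]; last first.
  by apply: hM => w; split; [exact: T_MSO_sentence Tp|exact: MSO_T_MSO].
(* The word is chosen for this sentence: its width and depth fix the numbers of variables and
   rounds. *)
have [s Es] := type_of_model (width p) (depth p) hM.
have [sp Hp] := Wp (word_of s).
have fvp : fv p = [::] by apply/nilP.
(* A sentence may be evaluated with all variables at bottom, the environment for which [run]
   computes the type. *)
apply/(@sat_fv _ _ p _ (fun=> s_bot M)); first by rewrite fvp.
have botE (N : structure Sigma) : bot_env (fun=> s_bot N) = (fun=> s_bot N).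
  by apply: funext => -[].
have hW := @MSO_T_MSO _ (word_of s).
have [|H _] := @sat_type _ (width p) (depth p) p _ _ (fun=> s_bot _)
  (fun=> s_bot M) hW hM (leqnn _) (leqnn _).
  by rewrite !botE Es type_of_word.
exact/H/Hp.
Qed.
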